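(* Let $M$ be a matroid on a ground set of size $n$, with fixing number $\mathrm{fix}(M)=k$, and let $s$ be the maximum size of an orbit of an element of the ground set under the action of $\mathrm{Aut}(M)$. Then: (1) $|\mathrm{Aut}(M)| \leq (n)_k$; (2) $|\mathrm{Aut}(M)| \leq s^k$; (3) $2^k \leq |\mathrm{Aut}(M)|$.
   Context: Matroids are on finite ground sets. An automorphism of a matroid $M$ on ground set $E$ is a bijection $\phi:E\to E$ such that, for every $C \subseteq E$, $\phi(C)$ is a circuit of $M$ if and only if $C$ is a circuit of $M$; $\mathrm{Aut}(M)$ is the group of automorphisms, acting on $E$. A subset $S\subseteq E$ is a fixing set if the only automorphism of $M$ that fixes every element of $S$ is the identity. The fixing number $\mathrm{fix}(M)$ is the minimum size of a fixing set of $M$. The notation $(n)_k = n(n-1)\cdots(n-k+1)$ denotes the falling factorial, with $(n)_0=1$. *)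

(* Defs.v *)
From mathcomp Require Import all_boot all_fingroup.

Set Implicit Arguments.
Unset Strict Implicit.
Unset Printing Implicit Defensive.

Import GroupScope.

(* The ground set is the whole finite type E. *)
Record matroid (E : finType) := Matroid {
  indep : {set {set E}};
  indep0 : set0 \in indep;
  indep_sub : forall I J : {set E}, J \in indep -> I \subset J -> I \in indep;
  indep_aug : forall I J : {set E}, I \in indep -> J \in indep -> #|I| < #|J| ->
    exists2 e, e \in J :\: I & e |: I \in indep
}.

Section MatroidAutomorphisms.
Variables (E : finType) (M : matroid E).

Definition circuit (C : {set E}) : bool :=
  minset [pred D : {set E} | D \notin indep M] C.

Definition matroid_automorphism (phi : {perm E}) : bool :=
  [forall C : {set E}, circuit (phi @: C) == circuit C].

Definition matroid_Aut : {set {perm E}} :=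
  [set phi : {perm E} | matroid_automorphism phi].

Lemma matroid_Aut_group_set : group_set matroid_Aut.
Proof.
apply/group_setP; split=> [|f g].
  rewrite inE; apply/forallP=> C; apply/eqP; congr circuit.
  rewrite -[RHS]imset_id; apply: eq_imset => x; exact: perm1.
rewrite !inE => /forallP Hf /forallP Hg; apply/forallP=> C.
rewrite -(eqP (Hf C)) -(eqP (Hg (f @: C))) -imset_comp.
by apply/eqP; congr circuit; apply: eq_imset => x; rewrite permM.
Qed.
Canonical matroid_Aut_group := Group matroid_Aut_group_set.

Definition fixing_set (S : {set E}) : bool :=
  [forall phi in matroid_Aut, [forall x in S, phi x == x] ==> (phi == 1)].

Lemma fixing_setT : fixing_set [set: E].
Proof.
apply/forall_inP=> phi _; apply/implyP=> /forall_inP fixE.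
by apply/eqP/permP=> x; rewrite perm1; apply/eqP/fixE; rewrite inE.
Qed.

(* The set [set: E] is always fixing (fixing_setT), so this minimum is
   attained at a fixing set. *)
Definition fixing_number : nat :=
  #|[arg min_(S < [set: E] | fixing_set S) #|S|]|.

Lemma fixing_number_exists : exists2 S, fixing_set S & #|S| = fixing_number.
Proof.
by rewrite /fixing_number; case: arg_minnP => [|S SP _];
  [exact: fixing_setT | exists S].
Qed.

Lemma fixing_number_min S : fixing_set S -> fixing_number <= #|S|.
Proof.
rewrite /fixing_number; case: arg_minnP => [|T _ Tmin]; first exact: fixing_setT.
exact: Tmin.
Qed.

(* 'P is the natural action of {perm E} on E. On the empty ground set this
   is 0, and then fixing_number is 0 as well. *)
Definition max_orbit_size : nat := \max_(x : E) #|orbit 'P matroid_Aut x|.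

End MatroidAutomorphisms.

(* Main.v *)
Require Import Defs.
From mathcomp Require Import all_boot all_fingroup.

(** An automorphism is determined by its values on a fixing set, which form an
    injective tuple; this gives (1). For (2), the pointwise stabiliser of a
    fixing set is reached from the whole group by stabilising one point at a
    time, each step having index at most [s] by orbit-stabiliser. For (3),
    stabilise greedily a point that is still moved: each step has index at
    least 2, and the chosen points form a fixing set. *)

Set Implicit Arguments.
Unset Strict Implicit.
Unset Printing Implicit Defensive.

Section PointwiseStabiliser.
Variables (aT : finGroupType) (T : finType) (to : {action aT &-> T}).
Implicit Types (G : {group aT}) (S : {set T}).

(** If [a] and [b] agree on [S], then [a * b^-1] lies in the trivial stabiliser, so [f] is injective
    on [G]. *)
Lemma card_le_ffact G S : 'C_G(S | to)%g = 1%g -> #|G| <= #|T| ^_ #|S|.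
Proof.
move=> trivC; pose f a := map_tuple (to^~ a) (enum_tuple S).
have injf : {in G &, injective f}.
  move=> a b Ga Gb /(congr1 val) /= /eq_in_map eq_ab.
  apply/eqP; rewrite eq_mulgV1.
  suff: (a * b^-1)%g \in 'C_G(S | to)%g by rewrite trivC inE.
  rewrite inE groupM ?groupV //=; apply/astabP=> x Sx.
  by rewrite actM eq_ab ?mem_enum // -actM mulgV act1.
rewrite -(card_in_imset injf) -card_uniq_tuples.
apply/subset_leq_card/subsetP=> _ /imsetP[a _ ->].
rewrite inE map_inj_uniq ?enum_uniq ?andbT; last exact: act_inj.
by apply/allP.
Qed.

Lemma setIC_astabU1 G x S : ('C_('C_G[x | to])(S | to) = 'C_G(x |: S | to))%g.
Proof. by rewrite astabU [RHS]setIA. Qed.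

Lemma setIC_astab0 G : ('C_G(set0 | to) = G)%g.
Proof. by apply/setIidPl/subsetP=> a _; apply/astabP=> x /[!inE]. Qed.

(** Induction on [#|S|] with [G] general: the step passes to the stabiliser of a point [x] of [S],
    whose orbits lie inside those of [G], so the bound [m] persists. *)
Lemma card_le_expn_orbit G S m :
    (forall x, x \in S -> #|orbit to G x| <= m) ->
  #|G| <= m ^ #|S| * #|'C_G(S | to)%g|.
Proof.
elim: {S}_.+1 {-2}S (ltnSn #|S|) G => // n IHn S leSn G le_m.
have [->|[x Sx]] := set_0Vmem S; first by rewrite cards0 mul1n setIC_astab0.
rewrite -(card_orbit_stab to G x) (cardsD1 x S) Sx expnS -mulnA.
apply: leq_mul; first exact: le_m.
rewrite -{2}(setD1K Sx) -setIC_astabU1.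
apply: IHn => [|y /setD1P[_ Sy]]; first by rewrite (cardsD1 x S) Sx in leSn.
apply: leq_trans (le_m y Sy); apply/subset_leq_card/imsetS/subsetIl.
Qed.

(** Induction on [#|G|]: the stabiliser of a moved point is a proper subgroup that still acts
    faithfully. *)
Lemma exists_small_base G :
  [faithful G, on setT | to] ->
  exists2 S, 'C_G(S | to)%g = 1%g & 2 ^ #|S| <= #|G|.
Proof.
elim: {G}_.+1 {-2}G (ltnSn #|G|) => // n IHn G leGn faithG.
have [trivG | ntG] := eqsVneq G 1%G.
  by exists set0; rewrite ?setIC_astab0 ?trivG // cards0 cards1.
(* If every orbit were a singleton, [G] would lie in the kernel of the action. *)
have [x ntx] : exists x, 1 < #|orbit to G x|.
  apply/existsP; apply: contraR ntG => /existsPn fixG.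
  rewrite -subG1; apply: subset_trans faithG; rewrite subsetI subxx /=.
  apply/subsetP=> a Ga; apply/astabP=> x _; apply/eqP.
  have/card_le1_eqP le1 : #|orbit to G x| <= 1 by rewrite leqNgt fixG.
  by apply/eqP/le1; rewrite ?orbit_refl ?mem_orbit.
have cardG := card_orbit_stab to G x.
have [||S trivC leS] := IHn [group of 'C_G[x | to]%g].
- by rewrite -ltnS (leq_trans _ leGn) // ltnS -cardG ltn_Pmull ?cardG_gt0.
- by apply: subset_trans faithG; rewrite setSI ?subsetIl.
exists (x |: S); first by rewrite -setIC_astabU1.
rewrite -cardG; apply: leq_trans (leq_mul ntx leS).
(* The bound [#|x |: S| <= #|S|.+1] also covers [x \in S]. *)
by rewrite -expnS leq_exp2l // cardsU1 -add1n leq_add2r leq_b1.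
Qed.

End PointwiseStabiliser.

(** Lets the lemmas on general group actions apply to fixing sets. *)
Lemma fixing_setE (E : finType) (M : matroid E) (S : {set E}) :
  fixing_set M S = ('C_(matroid_Aut M)(S | 'P) == 1)%g.
Proof.
rewrite -subG1; apply/forall_inP/subsetP => [fixS a | trivC a Aa].
  case/setIP=> Aa /astabP CSa; rewrite inE.
  by apply: (implyP (fixS a Aa)); apply/forall_inP=> x Sx; apply/eqP/CSa.
apply/implyP=> /forall_inP CSa; suff /trivC: a \in 'C_(matroid_Aut M)(S | 'P)%g by rewrite inE.
by rewrite inE Aa; apply/astabP=> x Sx; apply/eqP/CSa.
Qed.

Theorem theorem3p1 (E : finType) (M : matroid E) (n k s : nat)
    (card_E : #|E| = n) (fix_M : fixing_number M = k)
    (orbit_M : max_orbit_size M = s) :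
  [/\ #|matroid_Aut M| <= n ^_ k,
      #|matroid_Aut M| <= s ^ k
    & 2 ^ k <= #|matroid_Aut M| ].
Proof.
have [S] := fixing_number_exists M; rewrite fixing_setE => /eqP trivC.
rewrite fix_M => cardS; rewrite -card_E -cardS -orbit_M; split.
- exact: card_le_ffact trivC.
(* The added factor 1 is read as the order of the trivial stabiliser of [S]. *)
- rewrite -[_ ^ _]muln1 -(cards1 (1%g : {perm E})) -[X in _ * #|pred_of_set X|]trivC.
  by apply: card_le_expn_orbit => x _; apply: (leq_bigmax x).
have [|B trivB leB] := exists_small_base (to := 'P) (G := matroid_Aut_group M).
  exact: perm_faithful.
(* [B] is a fixing set, so [k <= #|B|] by minimality. *)
apply: leq_trans leB; rewrite leq_exp2l // cardS -fix_M.
by apply: fixing_number_min; rewrite fixing_setE trivB.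
Qed.
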